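(* Let $R$ be a commutative noetherian ring, let $C$ be a semidualizing $R$-module, let $M$ and $N$ be $R$-modules, and let $I$ be an injective $R$-module. For all $i\geq 0$ one has $$\operatorname{Ext}^i_{\mathcal{P}_C\mathcal{M}}(M,\operatorname{Hom}_R(N,I))\cong\operatorname{Hom}_R(\operatorname{Tor}^{\mathcal{P}_C\mathcal{M}}_i(M,N),I),$$ $$\operatorname{Ext}^i_{\mathcal{M}\mathcal{I}_C}(M,\operatorname{Hom}_R(N,I))\cong\operatorname{Hom}_R(\operatorname{Tor}^{\mathcal{M}\mathcal{P}_C}_i(M,N),I).$$
   Context: $R$ is a commutative noetherian ring. A finitely generated $R$-module $C$ is semidualizing if the homothety map $R\to\operatorname{Hom}_R(C,C)$ is an isomorphism and $\operatorname{Ext}^i_R(C,C)=0$ for all $i\geq 1$. $\mathcal{P}_C(R)$ is the class of $R$-modules isomorphic to $P\otimes_R C$ with $P$ projective, and $\mathcal{I}_C(R)$ is the class of $R$-modules isomorphic to $\operatorname{Hom}_R(C,E)$ with $E$ injective; the first is precovering and the second is preenveloping. A proper $\mathcal{P}_C$-resolution of $M$ is a complex $L=(\cdots\to L_1\to L_0\to 0)$ of modules in $\mathcal{P}_C(R)$ with an augmentation $L_0\to M$ such that $L^+=(\cdots\to L_1\to L_0\to M\to 0)$ is a complex (not necessarily exact) and $\operatorname{Hom}_R(Y,L^+)$ is exact for all $Y\in\mathcal{P}_C(R)$. Dually, a proper $\mathcal{I}_C$-coresolution of $N$ is a complex $J=(0\to J^0\to J^1\to\cdots)$ of modules in $\mathcal{I}_C(R)$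 with an augmentation $N\to J^0$ such that $J^+=(0\to N\to J^0\to J^1\to\cdots)$ is a complex and $\operatorname{Hom}_R(J^+,Y)$ is exact for all $Y\in\mathcal{I}_C(R)$. With $L$ a proper $\mathcal{P}_C$-resolution of $M$, $L'$ a proper $\mathcal{P}_C$-resolution of $N$, and $J$ a proper $\mathcal{I}_C$-coresolution of $N$, set for each $i\ge 0$: $\operatorname{Tor}^{\mathcal{P}_C\mathcal{M}}_i(M,N):=H_i(L\otimes_R N)$, $\operatorname{Tor}^{\mathcal{M}\mathcal{P}_C}_i(M,N):=H_i(M\otimes_R L')$, $\operatorname{Ext}^i_{\mathcal{P}_C\mathcal{M}}(M,N):=H_{-i}(\operatorname{Hom}_R(L,N))$, $\operatorname{Ext}^i_{\mathcal{M}\mathcal{I}_C}(M,N):=H_{-i}(\operatorname{Hom}_R(M,J))$ (the $i$-th cohomology). These are independent of choices. *)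

(* Defs.v *)
From HB Require Import structures.
From mathcomp Require Import all_boot all_algebra all_classical.

Set Implicit Arguments.
Unset Strict Implicit.
Unset Printing Implicit Defensive.

Import GRing.Theory.

Local Open Scope classical_set_scope.
Local Open Scope ring_scope.
Local Open Scope quotient_scope.

Definition isomorphic (R : pzRingType) (U V : lmodType R) : Prop :=
  exists f : {linear U -> V}, bijective f.

Section Submodule.
Variables (R : pzRingType) (U : lmodType R) (S : submodClosed U).

Definition submodule := {x : U | x \in S}.

HB.instance Definition _ := SubChoice.on submodule.
HB.instance Definition _ := [SubChoice_isSubLmodule of submodule by <:].

End Submodule.

Section QuotientModule.
Variables (R : pzRingType) (U : lmodType R) (S : submodClosed U).

(* [submodClosed] does not inherit from [zmodClosed], which the quotient of
   ring_quotient.v expects *)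
Definition zmod_pred : {pred U} := fun x => x \in S.

Lemma zmod_pred_closed : zmod_closed zmod_pred.
Proof. exact: GRing.submod_closedB (GRing.submodClosedP S). Qed.

HB.instance Definition _ := GRing.isZmodClosed.Build U zmod_pred
  zmod_pred_closed.

Definition quotmod := Quotient.quot zmod_pred.

HB.instance Definition _ := GRing.Zmodule.on quotmod.
HB.instance Definition _ := EqQuotient.on quotmod.

Definition quotmod_scale (a : R) (x : quotmod) : quotmod :=
  \pi_quotmod (a *: repr x).

Lemma quotmod_eqP (x y : U) :
  reflect (\pi_quotmod x = \pi_quotmod y) (x - y \in S).
Proof.
rewrite (_ : (x - y \in S) = (x - y \in (zmod_pred : {pred U}))) //.
rewrite Quotient.idealrBE; exact: eqP.
Qed.

Lemma quotmod_piD : {morph \pi_quotmod : x y / x + y}.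
Proof. by move=> x y; rewrite !piE. Qed.

Lemma quotmod_piZ a x : \pi_quotmod (a *: x) = quotmod_scale a (\pi x).
Proof.
apply/quotmod_eqP; rewrite -scalerBr rpredZ //.
by apply/quotmod_eqP; rewrite reprK.
Qed.

Fact quotmod_scaleA a b x :
  quotmod_scale a (quotmod_scale b x) = quotmod_scale (a * b) x.
Proof.
elim/quotW: x => x.
by rewrite -(quotmod_piZ b) -(quotmod_piZ a) -quotmod_piZ scalerA.
Qed.

Fact quotmod_scale1 : left_id 1 quotmod_scale.
Proof. by elim/quotW => x; rewrite -quotmod_piZ scale1r. Qed.

Fact quotmod_scaleDr : right_distributive quotmod_scale +%R.
Proof.
move=> a; elim/quotW => x; elim/quotW => y.
by rewrite -quotmod_piD -!quotmod_piZ -quotmod_piD scalerDr.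
Qed.

Fact quotmod_scaleDl x : {morph quotmod_scale^~ x : a b / a + b}.
Proof.
by elim/quotW: x => x a b; rewrite -!quotmod_piZ -quotmod_piD scalerDl.
Qed.

HB.instance Definition _ := GRing.Zmodule_isLmodule.Build R quotmod
  quotmod_scaleA quotmod_scale1 quotmod_scaleDr quotmod_scaleDl.

End QuotientModule.

Section KernelImage.
Variables (R : pzRingType) (U V : lmodType R) (f : {linear U -> V}).

Definition ker_pred : {pred U} := fun x => f x == 0.

Lemma ker_pred_closed : submod_closed ker_pred.
Proof.
split=> [|a x y]; rewrite !unfold_in ?linear0 //.
by move=> /eqP fx /eqP fy; rewrite linearP fx fy scaler0 addr0.
Qed.

HB.instance Definition _ := GRing.isSubmodClosed.Build R U
  ker_pred ker_pred_closed.

Definition im_pred : {pred V} := fun y => `[< exists x, f x = y >].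

Lemma im_pred_closed : submod_closed im_pred.
Proof.
split=> [|a x y]; rewrite !unfold_in.
  by apply/asboolP; exists 0; rewrite linear0.
move=> /asboolP[u <-] /asboolP[v <-]; apply/asboolP.
by exists (a *: u + v); rewrite linearP.
Qed.

HB.instance Definition _ := GRing.isSubmodClosed.Build R V
  im_pred im_pred_closed.

Definition preimage_pred (S : submodClosed V) : {pred U} := fun x => f x \in S.

Lemma preimage_pred_closed S : submod_closed (preimage_pred S).
Proof.
split=> [|a x y Sx Sy]; first by rewrite -[_ \in _]/(f 0 \in S) linear0 rpred0.
rewrite -[_ \in _]/(f (a *: x + y) \in S) linearP.
by apply: rpredD => //; apply: rpredZ.
Qed.

HB.instance Definition _ S :=
  GRing.isSubmodClosed.Build R U (preimage_pred S) (preimage_pred_closed S).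

End KernelImage.

(* [subquotient Z B] is Z / (Z :&: B). *)
Definition subquotient (R : pzRingType) (U : lmodType R)
    (Z B : submodClosed U) : lmodType R :=
  quotmod (preimage_pred (\val : {linear submodule Z -> U}) B).

Definition span_pred (R : pzRingType) (U : lmodType R) (G : set U) :
    {pred U} :=
  fun x => `[< forall S : submodClosed U,
                 (forall y, G y -> y \in S) -> x \in S >].

Lemma span_pred_closed (R : pzRingType) (U : lmodType R) (G : set U) :
  submod_closed (span_pred G).
Proof.
split=> [|a x y]; rewrite !unfold_in.
  by apply/asboolP => S _; apply: rpred0.
move=> /asboolP Gx /asboolP Gy; apply/asboolP => S GS.
by rewrite rpredD ?rpredZ ?Gx ?Gy.
Qed.

HB.instance Definition _ (R : pzRingType) (U : lmodType R) (G : set U) :=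
  GRing.isSubmodClosed.Build R U (span_pred G) (span_pred_closed G).

Definition HomMod (R : pzRingType) (M N : lmodType R) : Type := {linear M -> N}.

Section HomModule.
Variables (R : comPzRingType) (M N : lmodType R).

HB.instance Definition _ := gen_eqMixin (HomMod M N).
HB.instance Definition _ := gen_choiceMixin (HomMod M N).

Lemma hom_ext (f g : HomMod M N) : f =1 g -> f = g.
Proof.
case: f g => [f [[f1] [f2]]] [g [[g1] [g2]]] /= /funext fg.
case: _ / fg in g1 g2 *.
by rewrite (Prop_irrelevance f1 g1) (Prop_irrelevance f2 g2).
Qed.

Definition hom_zero : HomMod M N := \0.
Definition hom_opp (f : HomMod M N) : HomMod M N := \- f.
Definition hom_add (f g : HomMod M N) : HomMod M N := f \+ g.
Definition hom_scale (a : R) (f : HomMod M N) : HomMod M N := a \*: f.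

Fact hom_addA : associative hom_add.
Proof. by move=> f g h; apply: hom_ext => x /=; rewrite addrA. Qed.
Fact hom_addC : commutative hom_add.
Proof. by move=> f g; apply: hom_ext => x /=; rewrite addrC. Qed.
Fact hom_add0 : left_id hom_zero hom_add.
Proof. by move=> f; apply: hom_ext => x /=; rewrite add0r. Qed.
Fact hom_addN : left_inverse hom_zero hom_opp hom_add.
Proof. by move=> f; apply: hom_ext => x /=; rewrite addNr. Qed.

HB.instance Definition _ := GRing.isZmodule.Build (HomMod M N)
  hom_addA hom_addC hom_add0 hom_addN.

Fact hom_scaleA a b f : hom_scale a (hom_scale b f) = hom_scale (a * b) f.
Proof. by apply: hom_ext => x /=; rewrite scalerA. Qed.
Fact hom_scale1 : left_id 1 hom_scale.
Proof. by move=> f; apply: hom_ext => x /=; rewrite scale1r. Qed.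
Fact hom_scaleDr : right_distributive hom_scale +%R.
Proof. by move=> a f g; apply: hom_ext => x /=; rewrite scalerDr. Qed.
Fact hom_scaleDl f : {morph hom_scale^~ f : a b / a + b}.
Proof. by move=> a b; apply: hom_ext => x /=; rewrite scalerDl. Qed.

HB.instance Definition _ := GRing.Zmodule_isLmodule.Build R (HomMod M N)
  hom_scaleA hom_scale1 hom_scaleDr hom_scaleDl.

End HomModule.

Section HomMap.
Variables (R : comPzRingType) (M M' N N' : lmodType R).

Definition hom_post (g : {linear N -> N'}) : HomMod M N -> HomMod M N' :=
  fun f => g \o f.
Definition hom_pre (g : {linear M' -> M}) : HomMod M N -> HomMod M' N :=
  fun f => f \o g.

Lemma hom_post_linear g : linear (hom_post g).
Proof. by move=> a f h; apply: hom_ext => x /=; rewrite linearP. Qed.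
Lemma hom_pre_linear g : linear (hom_pre g).
Proof. by move=> a f h; apply: hom_ext. Qed.

HB.instance Definition _ g :=
  GRing.isLinear.Build R (HomMod M N) (HomMod M N') *:%R (hom_post g)
    (hom_post_linear g).
HB.instance Definition _ g :=
  GRing.isLinear.Build R (HomMod M N) (HomMod M' N) *:%R (hom_pre g)
    (hom_pre_linear g).

End HomMap.

Section FreeModule.
Variables (R : pzRingType) (X : choiceType).

Definition finite_support : {pred X -> R^o} :=
  fun f => `[< finite_set [set x | f x != 0] >].

Lemma finite_support_closed : submod_closed finite_support.
Proof.
split=> [|a f g]; rewrite !unfold_in.
  apply/asboolP; rewrite (_ : [set _ | _] = set0) // -subset0 => x /=.
  by rewrite eqxx.
move=> /asboolP ff /asboolP fg; apply/asboolP.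
apply: (@sub_finite_set _ _ ([set x | f x != 0] `|` [set x | g x != 0])).
  move=> x /=; apply: contra_neqP.
  move=> /not_orP[/negP/negPn/eqP fx /negP/negPn/eqP gx].
  have -> : (a *: f + g) x = a * f x + g x by [].
  by rewrite fx gx mulr0 addr0.
by rewrite finite_setU.
Qed.

HB.instance Definition _ := GRing.isSubmodClosed.Build R (X -> R^o)
  finite_support finite_support_closed.

Definition freemod : lmodType R := submodule finite_support.

Lemma basis_subproof (x : X) : (fun y => (y == x)%:R : R^o) \in finite_support.
Proof.
apply/asboolP; apply: (@sub_finite_set _ _ [set x]); last exact: finite_set1.
by move=> y /=; have [->//|_] := eqVneq y x; rewrite eqxx.
Qed.

Definition fbasis (x : X) : freemod :=
  exist (fun f => f \in finite_support) _ (basis_subproof x).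

Definition fcoef (u : freemod) (x : X) : R := \val u x.

Lemma coef_basis x y : fcoef (fbasis x) y = (y == x)%:R.
Proof. by []. Qed.

Lemma freemod_finite (u : freemod) : finite_set [set x | fcoef u x != 0].
Proof. exact: asboolW (valP u). Qed.

Variables (T : lmodType R) (b : X -> T).

Definition freemod_ext (u : freemod) : T := \sum_(x \in [set: X]) fcoef u x *: b x.

Lemma freemod_ext_supp (A : set X) (u : freemod) : finite_set A ->
    [set x | fcoef u x != 0] `<=` A ->
  freemod_ext u = \sum_(x \in A) fcoef u x *: b x.
Proof.
move=> finA uA; apply/esym/fsbig_widen => // x [_ /= xA].
by case: (eqVneq (fcoef u x) 0) => [->|/uA//]; rewrite scale0r.
Qed.

Lemma freemod_ext_linear : linear freemod_ext.
Proof.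
move=> a u v.
set A := [set x | fcoef u x != 0] `|` [set x | fcoef v x != 0].
have finA : finite_set A by rewrite finite_setU; split; exact: freemod_finite.
rewrite !(@freemod_ext_supp A) //; first last.
- move=> x /=; apply: contra_neqP.
  move=> /not_orP[/negP/negPn/eqP ux /negP/negPn/eqP vx].
  have -> : fcoef (a *: u + v) x = a * fcoef u x + fcoef v x by [].
  by rewrite ux vx mulr0 addr0.
- by move=> x ux; left.
- by move=> x vx; right.
rewrite !fsbig_finite //= scaler_sumr -big_split /=; apply: eq_bigr => x _.
have -> : fcoef (a *: u + v) x = a * fcoef u x + fcoef v x by [].
by rewrite scalerDl scalerA.
Qed.

HB.instance Definition _ := GRing.isLinear.Build R freemod T *:%R freemod_ext
  freemod_ext_linear.

Lemma freemod_ext_basis x : freemod_ext (fbasis x) = b x.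
Proof.
rewrite (@freemod_ext_supp [set x]) //.
  by rewrite fsbig_set1 coef_basis eqxx scale1r.
move=> y; rewrite /= coef_basis.
by have [->//|_] := eqVneq y x; rewrite eqxx.
Qed.

End FreeModule.

Lemma freemod_extE (R : pzRingType) (X : choiceType) (T : lmodType R)
    (h : {linear freemod R X -> T}) u :
  h u = freemod_ext (h \o fbasis R (X := X)) u.
Proof.
have finu := freemod_finite u.
rewrite (@freemod_ext_supp _ _ _ _ [set x | fcoef u x != 0]) //.
rewrite fsbig_finite //=.
set s : seq X := finmap.enum_fset _.
have s_uniq : uniq s by exact: finmap.fset_uniq.
have sP x : (x \in s) = (fcoef u x != 0).
  by rewrite in_fset_set // mem_setE.
transitivity (h (\sum_(x <- s) fcoef u x *: fbasis R x)); last first.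
  by rewrite linear_sum; apply: eq_bigr => x _; rewrite linearZ.
congr (h _); apply/val_inj/funext => y; rewrite raddf_sum fct_sumE /=.
transitivity (\sum_(x <- s) fcoef u x * (y == x)%:R); last by [].
have [uy|] := boolP (y \in s).
  rewrite (bigD1_seq y) //= eqxx mulr1 big1 ?addr0 //.
  by move=> x /negPf xy; rewrite eq_sym xy mulr0.
move=> ys; rewrite big_seq big1 => [|x xs].
  by move: ys; rewrite sP negbK => /eqP.
have [yx|_] := eqVneq y x; last by rewrite mulr0.
by rewrite yx xs in ys.
Qed.

Section Tensor.
Variables (R : comPzRingType) (M N : lmodType R).

Inductive tensor_relator : set (freemod R (M * N)%type) :=
| tensor_addl x x' y :
    tensor_relator (fbasis R (x + x', y) - fbasis R (x, y) - fbasis R (x', y))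
| tensor_addr x y y' :
    tensor_relator (fbasis R (x, y + y') - fbasis R (x, y) - fbasis R (x, y'))
| tensor_scalel a x y :
    tensor_relator (fbasis R (a *: x, y) - a *: fbasis R (x, y))
| tensor_scaler a x y :
    tensor_relator (fbasis R (x, a *: y) - a *: fbasis R (x, y)).

Definition tensor : lmodType R := quotmod (span_pred tensor_relator).

Definition tens (x : M) (y : N) : tensor := \pi_tensor (fbasis R (x, y)).

Lemma tensDl x x' y : tens (x + x') y = tens x y + tens x' y.
Proof.
rewrite /tens -quotmod_piD; apply/quotmod_eqP/asboolP => S; apply.
by rewrite opprD addrA; exact: tensor_addl.
Qed.

Lemma tensDr x y y' : tens x (y + y') = tens x y + tens x y'.
Proof.
rewrite /tens -quotmod_piD; apply/quotmod_eqP/asboolP => S; apply.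
by rewrite opprD addrA; exact: tensor_addr.
Qed.

Lemma tensZl a x y : tens (a *: x) y = a *: tens x y.
Proof.
rewrite /tens -[RHS]quotmod_piZ; apply/quotmod_eqP/asboolP => S; apply.
exact: tensor_scalel.
Qed.

Lemma tensZr a x y : tens x (a *: y) = a *: tens x y.
Proof.
rewrite /tens -[RHS]quotmod_piZ; apply/quotmod_eqP/asboolP => S; apply.
exact: tensor_scaler.
Qed.

Variables (T : lmodType R) (b : M -> N -> T).

Definition tensor_lift (t : tensor) : T :=
  freemod_ext (fun p => b p.1 p.2) (repr t).

Hypothesis b_linear_l : forall y, linear (b^~ y).
Hypothesis b_linear_r : forall x, linear (b x).

Lemma tensor_lift_pi (u : freemod R (M * N)%type) :
  tensor_lift (\pi_tensor u) = freemod_ext (fun p => b p.1 p.2) u.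
Proof.
pose h : {linear _ -> T} := @freemod_ext R _ T (fun p : M * N => b p.1 p.2).
rewrite -[LHS]/(h _) -[RHS]/(h u); apply/eqP.
rewrite -subr_eq0 -linearB -[_ == 0]/(_ \in ker_pred h).
have /quotmod_eqP/asboolP : \pi_tensor (repr (\pi_tensor u)) = \pi_tensor u.
  by rewrite reprK.
apply => _ [x x' y|x y y'|a x y|a x y].
- rewrite -[_ \in _]/(h _ == 0) !linearB /= !freemod_ext_basis /=.
  have := b_linear_l y 1 x x'; rewrite !scale1r => ->.
  by rewrite -addrA -opprD subrr.
- rewrite -[_ \in _]/(h _ == 0) !linearB /= !freemod_ext_basis /=.
  have := b_linear_r x 1 y y'; rewrite !scale1r => ->.
  by rewrite -addrA -opprD subrr.
- rewrite -[_ \in _]/(h _ == 0) linearB linearZ /= !freemod_ext_basis /=.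
  have b0 : b 0 y = 0.
    by have := b_linear_l y (-1) 0 0; rewrite scaler0 addr0 scaleN1r addNr.
  by have := b_linear_l y a x 0; rewrite b0 !addr0 => ->; rewrite subrr.
- rewrite -[_ \in _]/(h _ == 0) linearB linearZ /= !freemod_ext_basis /=.
  have b0 : b x 0 = 0.
    by have := b_linear_r x (-1) 0 0; rewrite scaler0 addr0 scaleN1r addNr.
  by have := b_linear_r x a y 0; rewrite b0 !addr0 => ->; rewrite subrr.
Qed.

Lemma tensor_lift_tens x y : tensor_lift (tens x y) = b x y.
Proof. by rewrite /tens tensor_lift_pi freemod_ext_basis. Qed.

Lemma tensor_lift_linear : linear tensor_lift.
Proof.
move=> a; elim/quotW => u; elim/quotW => v.
have -> : a *: \pi_tensor u + \pi_tensor v = \pi_tensor (a *: u + v).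
  by rewrite quotmod_piD quotmod_piZ.
rewrite !tensor_lift_pi; exact: freemod_ext_linear.
Qed.

End Tensor.

Section TensorMap.
Variables (R : comPzRingType) (M M' N N' : lmodType R).
Variables (f : {linear M -> M'}) (g : {linear N -> N'}).

Definition tensor_map : tensor M N -> tensor M' N' :=
  tensor_lift (fun x y => tens (f x) (g y)).

Lemma tensor_map_linear : linear tensor_map.
Proof.
apply: tensor_lift_linear => [y a x x'|x a y y'].
  by rewrite linearP tensDl tensZl.
by rewrite linearP tensDr tensZr.
Qed.

Lemma tensor_map_tens x y : tensor_map (tens x y) = tens (f x) (g y).
Proof.
apply: tensor_lift_tens => [{}y a {}x x'|{}x a {}y y'].
  by rewrite linearP tensDl tensZl.
by rewrite linearP tensDr tensZr.
Qed.

HB.instance Definition _ :=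
  GRing.isLinear.Build R (tensor M N) (tensor M' N') *:%R tensor_map
    tensor_map_linear.

End TensorMap.

Lemma tensor_ext (R : comPzRingType) (M N T : lmodType R)
    (f g : {linear tensor M N -> T}) :
  (forall x y, f (tens x y) = g (tens x y)) -> f =1 g.
Proof.
move=> fg; elim/quotW => u.
pose p : freemod R (M * N)%type -> tensor M N := \pi_(tensor M N).
have p_linear : linear p.
  by move=> a x y; rewrite /p quotmod_piD quotmod_piZ.
pose P : {linear _ -> _} := HB.pack p (GRing.isLinear.Build _ _ _ _ p p_linear).
rewrite -[LHS]/((f \o P) u) -[RHS]/((g \o P) u) freemod_extE [RHS]freemod_extE.
by congr (freemod_ext _ u); apply/funext => -[x y]; exact: fg.
Qed.

Lemma tensor_map_comp0 (R : comPzRingType) (M M' M'' N N' N'' : lmodType R)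
    (f : {linear M -> M'}) (f' : {linear M' -> M''})
    (g : {linear N -> N'}) (g' : {linear N' -> N''}) :
  (forall x y, tens (f' (f x)) (g' (g y)) = 0) ->
  forall t, tensor_map f' g' (tensor_map f g t) = 0.
Proof.
move=> fg0.
apply: (@tensor_ext _ _ _ _ (tensor_map f' g' \o tensor_map f g) \0).
by move=> x y; rewrite /= !tensor_map_tens.
Qed.

Lemma tens0l (R : comPzRingType) (M N : lmodType R) (y : N) :
  tens (0 : M) y = 0.
Proof. by rewrite -(scale0r (0 : M)) tensZl scale0r. Qed.

Lemma tens0r (R : comPzRingType) (M N : lmodType R) (x : M) :
  tens x (0 : N) = 0.
Proof. by rewrite -(scale0r (0 : N)) tensZr scale0r. Qed.

Record chain_complex (R : pzRingType) := ChainComplex {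
  chain_obj :> nat -> lmodType R;
  chain_diff : forall n, {linear chain_obj n.+1 -> chain_obj n};
  chain_diff_diff : forall n x, chain_diff n (chain_diff n.+1 x) = 0
}.

Record cochain_complex (R : pzRingType) := CochainComplex {
  cochain_obj :> nat -> lmodType R;
  cochain_diff : forall n, {linear cochain_obj n -> cochain_obj n.+1};
  cochain_diff_diff : forall n x, cochain_diff n.+1 (cochain_diff n x) = 0
}.

Section Homology.
Variables (R : pzRingType) (X : chain_complex R).

Definition cycles (n : nat) : {pred X n} :=
  match n return {pred X n} with
  | 0 => xpredT
  | m.+1 => ker_pred (chain_diff X m)
  end.

Definition boundaries (n : nat) : {pred X n} := im_pred (chain_diff X n).

Arguments cycles : clear implicits.
Arguments boundaries : clear implicits.

Lemma cycles_closed n : submod_closed (cycles n).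
Proof. by case: n => [|n]; [split|exact: ker_pred_closed]. Qed.

HB.instance Definition _ n :=
  GRing.isSubmodClosed.Build R (X n) (cycles n) (cycles_closed n).
HB.instance Definition _ n := GRing.isSubmodClosed.Build R (X n) (boundaries n)
  (im_pred_closed (chain_diff X n)).

Definition homology (n : nat) : lmodType R :=
  subquotient (cycles n) (boundaries n).

Definition chain_exact : Prop :=
  forall n x, x \in cycles n -> x \in boundaries n.

End Homology.

Arguments cycles {R} X n.
Arguments boundaries {R} X n.

Section Cohomology.
Variables (R : pzRingType) (X : cochain_complex R).

Definition cocycles (n : nat) : {pred X n} := ker_pred (cochain_diff X n).

Definition coboundaries (n : nat) : {pred X n} :=
  match n return {pred X n} with
  | 0 => pred1 0
  | m.+1 => im_pred (cochain_diff X m)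
  end.

Arguments cocycles : clear implicits.
Arguments coboundaries : clear implicits.

Lemma coboundaries_closed n : submod_closed (coboundaries n).
Proof.
case: n => [|n]; last exact: im_pred_closed.
split=> [|a x y]; rewrite ?inE // => /eqP-> /eqP->.
by rewrite scaler0 addr0.
Qed.

HB.instance Definition _ n := GRing.isSubmodClosed.Build R (X n) (cocycles n)
  (ker_pred_closed (cochain_diff X n)).
HB.instance Definition _ n := GRing.isSubmodClosed.Build R (X n)
  (coboundaries n) (coboundaries_closed n).

Definition cohomology (n : nat) : lmodType R :=
  subquotient (cocycles n) (coboundaries n).

Definition cochain_exact : Prop :=
  forall n x, x \in cocycles n -> x \in coboundaries n.

End Cohomology.

Arguments cocycles {R} X n.
Arguments coboundaries {R} X n.

Record augmented (R : pzRingType) (M : lmodType R) := Augmented {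
  aug_chain :> chain_complex R;
  aug_map : {linear aug_chain 0 -> M};
  aug_map_diff : forall x, aug_map (chain_diff aug_chain 0 x) = 0
}.

Record coaugmented (R : pzRingType) (N : lmodType R) := Coaugmented {
  coaug_cochain :> cochain_complex R;
  coaug_map : {linear N -> coaug_cochain 0};
  coaug_diff_map : forall x, cochain_diff coaug_cochain 0 (coaug_map x) = 0
}.

(* The complexes L^+ and J^+, with the augmented module in degree 0 and
   everything else shifted by one. *)
Section Plus.
Variable R : pzRingType.

Section Chain.
Variables (M : lmodType R) (L : augmented M).

Definition plus_obj (n : nat) : lmodType R :=
  match n with 0 => M | m.+1 => L m end.

Definition plus_diff (n : nat) : {linear plus_obj n.+1 -> plus_obj n} :=
  match n return {linear plus_obj n.+1 -> plus_obj n} with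
  | 0 => aug_map L
  | m.+1 => chain_diff L m
  end.

Lemma plus_diff_diff n x : plus_diff n (plus_diff n.+1 x) = 0.
Proof.
by case: n x => [|n] x; [exact: aug_map_diff|exact: chain_diff_diff].
Qed.

Definition chain_plus : chain_complex R := ChainComplex plus_diff_diff.

End Chain.

Section Cochain.
Variables (N : lmodType R) (J : coaugmented N).

Definition coplus_obj (n : nat) : lmodType R :=
  match n with 0 => N | m.+1 => J m end.

Definition coplus_diff (n : nat) : {linear coplus_obj n -> coplus_obj n.+1} :=
  match n return {linear coplus_obj n -> coplus_obj n.+1} with
  | 0 => coaug_map J
  | m.+1 => cochain_diff J m
  end.

Lemma coplus_diff_diff n x : coplus_diff n.+1 (coplus_diff n x) = 0.
Proof.
by case: n x => [|n] x; [exact: coaug_diff_map|exact: cochain_diff_diff].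
Qed.

Definition cochain_plus : cochain_complex R := CochainComplex coplus_diff_diff.

End Cochain.

End Plus.

(* The differentials are the induced maps, without the customary signs in HomMod
   complexes; this changes neither cycles nor boundaries. *)
Section Functors.
Variable R : comPzRingType.

Section Chain.
Variables (Y : lmodType R) (X : chain_complex R).

Lemma chain_HomY_subproof n (f : HomMod Y (X n.+2)) :
  hom_post (chain_diff X n) (hom_post (chain_diff X n.+1) f) = 0.
Proof. by apply: hom_ext => y; exact: chain_diff_diff. Qed.

Lemma chain_HomX_subproof n (f : HomMod (X n) Y) :
  hom_pre (chain_diff X n.+1) (hom_pre (chain_diff X n) f) = 0.
Proof. by apply: hom_ext => x /=; rewrite chain_diff_diff linear0. Qed.

Lemma chain_tensorl_subproof n (t : tensor Y (X n.+2)) :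
  tensor_map idfun (chain_diff X n)
    (tensor_map idfun (chain_diff X n.+1) t) = 0.
Proof. by apply: tensor_map_comp0 => y x; rewrite chain_diff_diff tens0r. Qed.

Lemma chain_tensorr_subproof n (t : tensor (X n.+2) Y) :
  tensor_map (chain_diff X n) idfun
    (tensor_map (chain_diff X n.+1) idfun t) = 0.
Proof. by apply: tensor_map_comp0 => x y; rewrite chain_diff_diff tens0l. Qed.

Definition Hom_to_chain : chain_complex R :=
  @ChainComplex R (fun n => HomMod Y (X n)) (fun n => hom_post (chain_diff X n))
    chain_HomY_subproof.

Definition Hom_from_chain : cochain_complex R :=
  @CochainComplex R (fun n => HomMod (X n) Y)
    (fun n => hom_pre (chain_diff X n)) chain_HomX_subproof.

Definition tensor_module_chain : chain_complex R :=
  @ChainComplex R (fun n => tensor Y (X n))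
    (fun n => tensor_map idfun (chain_diff X n)) chain_tensorl_subproof.

Definition tensor_chain_module : chain_complex R :=
  @ChainComplex R (fun n => tensor (X n) Y)
    (fun n => tensor_map (chain_diff X n) idfun) chain_tensorr_subproof.

End Chain.

Section Cochain.
Variables (Y : lmodType R) (X : cochain_complex R).

Lemma cochain_HomY_subproof n (f : HomMod Y (X n)) :
  hom_post (cochain_diff X n.+1) (hom_post (cochain_diff X n) f) = 0.
Proof. by apply: hom_ext => y; exact: cochain_diff_diff. Qed.

Lemma cochain_HomX_subproof n (f : HomMod (X n.+2) Y) :
  hom_pre (cochain_diff X n) (hom_pre (cochain_diff X n.+1) f) = 0.
Proof. by apply: hom_ext => x /=; rewrite cochain_diff_diff linear0. Qed.

Definition Hom_to_cochain : cochain_complex R :=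
  @CochainComplex R (fun n => HomMod Y (X n))
    (fun n => hom_post (cochain_diff X n)) cochain_HomY_subproof.

Definition Hom_from_cochain : chain_complex R :=
  @ChainComplex R (fun n => HomMod (X n) Y)
    (fun n => hom_pre (cochain_diff X n)) cochain_HomX_subproof.

End Cochain.

End Functors.

Definition finitely_generated (R : pzRingType) (M : lmodType R) : Prop :=
  exists (n : nat) (g : 'I_n -> M),
    forall x, exists a : 'I_n -> R, x = \sum_(i < n) a i *: g i.

Definition noetherian (R : comPzRingType) : Prop :=
  forall I : submodClosed R^o, finitely_generated (submodule I).

Definition projective_module (R : pzRingType) (P : lmodType R) : Prop :=
  forall (A B : lmodType R) (p : {linear A -> B}) (f : {linear P -> B}),
    (forall b, exists a, p a = b) ->
    exists g : {linear P -> A}, forall x, p (g x) = f x.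

Definition injective_module (R : pzRingType) (E : lmodType R) : Prop :=
  forall (A B : lmodType R) (j : {linear A -> B}) (f : {linear A -> E}),
    injective j -> exists g : {linear B -> E}, forall x, g (j x) = f x.

Definition projective_resolution (R : pzRingType) (M : lmodType R)
    (P : augmented M) : Prop :=
  (forall n, projective_module (P n)) /\ chain_exact (chain_plus P).

(* The absolute Ext, read off a projective resolution P of M; it does not depend
   on P up to isomorphism. *)
Definition Ext (R : comPzRingType) (M : lmodType R) (P : augmented M)
    (N : lmodType R) (i : nat) : lmodType R :=
  cohomology (Hom_from_chain N P) i.

Definition homothety (R : comPzRingType) (C : lmodType R) (r : R) : HomMod C C :=
  r \*: idfun.

Definition semidualizing (R : comPzRingType) (C : lmodType R) : Prop :=
  [/\ finitely_generated C,
      bijective (@homothety R C)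
    & forall P : augmented C, projective_resolution P ->
        forall i, (1 <= i)%N -> forall x : Ext P C i, x = 0].

Section Relative.
Variables (R : comPzRingType) (C : lmodType R).

Definition PC (X : lmodType R) : Prop :=
  exists P : lmodType R, projective_module P /\ isomorphic X (tensor P C).

Definition IC (X : lmodType R) : Prop :=
  exists E : lmodType R, injective_module E /\ isomorphic X (HomMod C E).

Definition proper_PC_resolution (M : lmodType R) (L : augmented M) : Prop :=
  (forall n, PC (L n)) /\
  forall Y, PC Y -> chain_exact (Hom_to_chain Y (chain_plus L)).

Definition proper_IC_coresolution (N : lmodType R) (J : coaugmented N) : Prop :=
  (forall n, IC (J n)) /\
  forall Y, IC Y -> chain_exact (Hom_from_cochain Y (cochain_plus J)).

End Relative.

(* As for Ext, these take the (co)resolution as an argument and do not depend on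
   it up to isomorphism as long as it is proper; Tor_PCM resolves M and Tor_MPC
   resolves N. *)

Definition Tor_PCM (R : comPzRingType) (M : lmodType R) (L : augmented M)
    (N : lmodType R) (i : nat) : lmodType R :=
  homology (tensor_chain_module N L) i.

Definition Tor_MPC (R : comPzRingType) (M N : lmodType R) (L : augmented N)
    (i : nat) : lmodType R :=
  homology (tensor_module_chain M L) i.

Definition Ext_PCM (R : comPzRingType) (M : lmodType R) (L : augmented M)
    (N : lmodType R) (i : nat) : lmodType R :=
  cohomology (Hom_from_chain N L) i.

Definition Ext_MIC (R : comPzRingType) (M N : lmodType R) (J : coaugmented N)
    (i : nat) : lmodType R :=
  cohomology (Hom_to_cochain M J) i.

(* Main.v *)
From HB Require Import structures.
From mathcomp Require Import all_boot all_algebra all_classical.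
Require Import Defs.

(** Since I is injective, applying Hom(-, I) to a complex X turns homology into its dual: H^i(Hom(X, I)) = Hom(H_i(X), I)
    ([cohomology_Hom_injective]).  Combined with the adjunction
    Hom(A, Hom(B, I)) = Hom(A (x) B, I), which is natural in A and in B, this
    gives both isomorphisms for suitably matched resolutions:
    - Hom(L', Hom(N, I)) = Hom(L' (x) N, I) for a proper P_C-resolution L' of M;
    - Hom(M, Hom(L, I)) = Hom(M (x) L, I) for a proper P_C-resolution L of N.

    It remains to replace the resolutions occurring here by arbitrary ones.  Two
    proper resolutions of the same module are homotopy equivalent, by the usual
    lifting argument relative to the class P_C.  That argument only composes,
    adds and lifts morphisms, so it is carried out in an additive category
    ([comparison]); applied to modules it handles P_C-resolutions, and applied
    to the opposite category it handles I_C-coresolutions.  This settles the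
    first isomorphism, and the second one once Hom(L, I) is known to be a proper
    I_C-coresolution of Hom(N, I) ([proper_dual_coaugmented]).

    The terms of Hom(L, I) are in I_C because Hom(P (x) C, I) = Hom(C, Hom(P, I))
    and Hom(P, I) is injective for P projective ([injective_Hom_projective]).
    For properness, Hom(Hom(L^+, I), Hom(C, E)) = Hom(C (x) Hom(L^+, I), E) with E
    injective, so it is enough that C (x) Hom(L^+, I) is exact.  Over a noetherian
    ring C is finitely presented, hence tensor evaluation
    C (x) Hom(X, I) -> Hom(Hom(C, X), I) is bijective
    ([tensor_eval_surjective], [tensor_eval_injective]); and
    Hom(Hom(C, L^+), I) is exact because C itself lies in P_C. *)

Set Implicit Arguments.
Unset Strict Implicit.
Unset Printing Implicit Defensive.

Import GRing.Theory.

Local Open Scope classical_set_scope.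
Local Open Scope ring_scope.
Local Open Scope quotient_scope.

(** * Isomorphisms, quotients and injective modules *)

Lemma bijective_of_surjective (A B : Type) (f : A -> B) :
  injective f -> (forall b, exists a, f a = b) -> bijective f.
Proof.
move=> f_inj /choice[g fgK]; exists g => // a.
exact/f_inj/fgK.
Qed.

Definition mk_linear (R : pzRingType) (U V : lmodType R) (f : U -> V)
    (fL : linear f) : {linear U -> V} :=
  HB.pack f (GRing.isLinear.Build R U V *:%R f fL).

Definition in_submodule (R : pzRingType) (U : lmodType R) (S : submodClosed U)
    (x : U) (xS : x \in S) : submodule S :=
  exist (fun y => y \in S) x xS.

Section Isomorphic.
Variable R : pzRingType.
Implicit Types U V W : lmodType R.

Lemma can_linear U V (f : {linear U -> V}) (g : V -> U) :
  cancel f g -> cancel g f -> linear g.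
Proof. by move=> fK gK a x y; apply: (can_inj fK); rewrite linearP !gK. Qed.

Lemma isomorphic_inverse U V : isomorphic U V ->
  exists (f : {linear U -> V}) (g : {linear V -> U}), cancel f g /\ cancel g f.
Proof.
by case=> f [g fK gK]; exists f, (mk_linear (can_linear fK gK)).
Qed.

Lemma isomorphic_trans V U W :
  isomorphic U V -> isomorphic V W -> isomorphic U W.
Proof. by case=> f fb [g gb]; exists (g \o f); exact: bij_comp. Qed.

Lemma quotmod_pi_linear U (S : submodClosed U) :
  linear (\pi_(quotmod S) : U -> quotmod S).
Proof. by move=> a x y; rewrite quotmod_piD quotmod_piZ. Qed.

Lemma quotmod_pi_eq0 U (S : submodClosed U) (x : U) :
  \pi_(quotmod S) x = 0 <-> x \in S.
Proof.
rewrite -(linear0 (mk_linear (@quotmod_pi_linear U S))).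
by split=> [/quotmod_eqP|xS]; [|apply/quotmod_eqP]; rewrite subr0.
Qed.

Lemma quotmod_lift U V (S : submodClosed U) (k : {linear U -> V}) :
    (forall x, x \in S -> k x = 0) ->
  exists f : {linear quotmod S -> V}, forall x, f (\pi_(quotmod S) x) = k x.
Proof.
move=> kS.
have reprE x : k (repr (\pi_(quotmod S) x)) = k x.
  apply/eqP; rewrite -subr_eq0 -linearB; apply/eqP/kS/quotmod_eqP.
  by rewrite reprK.
have kL : linear (fun q : quotmod S => k (repr q)).
  move=> a; elim/quotW => x; elim/quotW => y.
  by rewrite -quotmod_pi_linear !reprE linearP.
by exists (mk_linear kL).
Qed.

(** First isomorphism theorem for the subquotients that define homology. *)
Lemma subquotient_isomorphic U W (Z B : submodClosed U)
    (k : {linear submodule Z -> W}) :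
    (forall z, k z = 0 <-> \val z \in B) -> (forall w, exists z, k z = w) ->
  isomorphic (subquotient Z B) W.
Proof.
move=> kB k_surj.
have [x /kB //|f fE] := @quotmod_lift _ _
  (preimage_pred (\val : {linear submodule Z -> U}) B) k.
exists f; apply: bijective_of_surjective => [|w]; last first.
  by have [z <-] := k_surj w; exists (\pi z); rewrite fE.
elim/quotW => x; elim/quotW => y; rewrite !fE => xy.
apply/quotmod_eqP; rewrite -[_ \in _]/(\val (x - y) \in B).
by apply/kB; rewrite linearB xy subrr.
Qed.

Lemma subquotient_map_isomorphic U V (Z B : submodClosed U)
    (Z' B' : submodClosed V) (f : {linear U -> V}) :
    (forall z, z \in Z -> f z \in Z') ->
    (forall z, z \in Z -> f z \in B' <-> z \in B) ->
    (forall z', z' \in Z' -> exists2 z, z \in Z & f z - z' \in B') ->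
  isomorphic (subquotient Z B) (subquotient Z' B').
Proof.
move=> fZ fB f_surj.
pose q : submodule Z' -> subquotient Z' B' := \pi_(quotmod _).
pose c (z : submodule Z) : submodule Z' :=
  in_submodule (fZ _ (valP z)).
have kL : linear (q \o c).
  move=> a x y; rewrite /= -quotmod_pi_linear; congr (q _).
  by apply/val_inj; rewrite /= linearP.
apply: (@subquotient_isomorphic _ _ _ _ (mk_linear kL)) => [z|].
  by rewrite /= -fB ?(valP z) //; apply: quotmod_pi_eq0.
elim/quotW => z'; have [z zZ zz'] := f_surj _ (valP z').
by exists (in_submodule zZ); apply/quotmod_eqP.
Qed.

(** Injectivity in the form used throughout: f induces a map on the image of q,
    a submodule of V, and that map extends to V. *)
Lemma injective_factor U V (E : lmodType R) (q : {linear U -> V})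
    (f : {linear U -> E}) :
    injective_module E -> (forall x, q x = 0 -> f x = 0) ->
  exists g : {linear V -> E}, forall x, g (q x) = f x.
Proof.
move=> E_inj kqf; pose S : submodClosed V := im_pred q.
have preim (y : submodule S) : exists x, q x = \val y := asboolW (valP y).
have [r rK] := choice preim.
have fE x y : q x = q y -> f x = f y.
  move=> xy; apply/eqP; rewrite -subr_eq0 -linearB kqf //.
  by rewrite linearB xy subrr.
have hL : linear (f \o r).
  by move=> a x y; rewrite /= -linearP; apply: fE; rewrite linearP !rK linearP.
have [g gE] := E_inj _ _ (\val : {linear submodule S -> V}) (mk_linear hL)
  val_inj.
exists g => x; have xS : q x \in S by apply/asboolP; exists x.
by rewrite (gE (in_submodule xS)) /=; apply: fE; rewrite rK.
Qed.

End Isomorphic.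

Lemma cocyclesE (R : pzRingType) (X : cochain_complex R) n (x : X n) :
  (x \in cocycles X n) = (cochain_diff X n x == 0).
Proof. by []. Qed.

Lemma coboundaries0E (R : pzRingType) (X : cochain_complex R) (x : X 0) :
  (x \in coboundaries X 0) = (x == 0).
Proof. by []. Qed.

Lemma coboundariesSP (R : pzRingType) (X : cochain_complex R) n (x : X n.+1) :
  reflect (exists y, cochain_diff X n y = x) (x \in coboundaries X n.+1).
Proof. exact: asboolP. Qed.

Lemma cyclesSE (R : pzRingType) (X : chain_complex R) n (x : X n.+1) :
  (x \in cycles X n.+1) = (chain_diff X n x == 0).
Proof. by []. Qed.

Lemma boundariesP (R : pzRingType) (X : chain_complex R) n (x : X n) :
  reflect (exists y, chain_diff X n y = x) (x \in boundaries X n).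
Proof. exact: asboolP. Qed.

Definition cochain_map (R : pzRingType) (X Y : cochain_complex R)
    (f : forall n, {linear X n -> Y n}) : Prop :=
  forall n x, cochain_diff Y n (f n x) = f n.+1 (cochain_diff X n x).

Lemma cochain_map_cocycles (R : pzRingType) (X Y : cochain_complex R)
    (f : forall n, {linear X n -> Y n}) n x : cochain_map f ->
  x \in cocycles X n -> f n x \in cocycles Y n.
Proof.
by move=> fd; rewrite !cocyclesE fd => /eqP->; rewrite linear0.
Qed.

Lemma cochain_map_coboundaries (R : pzRingType) (X Y : cochain_complex R)
    (f : forall n, {linear X n -> Y n}) n x : cochain_map f ->
  x \in coboundaries X n -> f n x \in coboundaries Y n.
Proof.
move=> fd; case: n x => [|n] x.
  by rewrite !coboundaries0E => /eqP->; rewrite linear0.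
by case/coboundariesSP => y <-; apply/coboundariesSP; exists (f n y); apply: fd.
Qed.

Lemma cohomology_isomorphic (R : pzRingType) (X Y : cochain_complex R)
    (f : forall n, {linear X n -> Y n}) (g : forall n, {linear Y n -> X n}) :
    cochain_map f -> cochain_map g ->
    (forall n x, x \in cocycles X n -> g n (f n x) - x \in coboundaries X n) ->
    (forall n y, y \in cocycles Y n -> f n (g n y) - y \in coboundaries Y n) ->
  forall n, isomorphic (cohomology X n) (cohomology Y n).
Proof.
move=> fd gd gf fg n.
apply: (@subquotient_map_isomorphic _ _ _ _ _ _ _ (f n)) => [z zZ|z zZ|y yZ].
- exact: cochain_map_cocycles.
- split=> [/(cochain_map_coboundaries gd)|]; last exact: cochain_map_coboundaries.
  move/(@rpredB _ (coboundaries X n) _ _)/(_ (gf n z zZ)).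
  by rewrite opprB addrC subrK.
- by exists (g n y); [exact: cochain_map_cocycles|exact: fg].
Qed.

Lemma cohomology_isomorphic_levelwise (R : pzRingType) (X Y : cochain_complex R)
    (f : forall n, {linear X n -> Y n}) (g : forall n, Y n -> X n) :
    cochain_map f -> (forall n, cancel (f n) (g n)) ->
    (forall n, cancel (g n) (f n)) ->
  forall n, isomorphic (cohomology X n) (cohomology Y n).
Proof.
move=> fd fK gK.
apply: (@cohomology_isomorphic _ X Y f
  (fun n => mk_linear (can_linear (fK n) (gK n)))) => // [n y|n x _|n y _] /=.
- by apply: (can_inj (fK n.+1)); rewrite -fd !gK.
- by rewrite fK subrr rpred0.
- by rewrite gK subrr rpred0.
Qed.

(** * Dualizing homology into an injective module *)

(** A cocycle is a map X_n -> I killing boundaries, so it restricts to the cycles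
    and descends to H_n(X).  By injectivity every map H_n(X) -> I arises in this
    way, and a map that vanishes on the cycles factors through the differential,
    i.e. is a coboundary.  In degree 0 every chain is a cycle and only 0 is a
    coboundary, so the last claim holds there too. *)
Lemma cohomology_Hom_injective (R : comPzRingType) (X : chain_complex R)
    (I : lmodType R) (n : nat) : injective_module I ->
  isomorphic (cohomology (Hom_from_chain I X) n) (HomMod (homology X n) I).
Proof.
move=> I_inj; pose Y := Hom_from_chain I X.
have kerE (f : Y n) :
    (forall x, x \in cycles X n -> (f : HomMod _ _) x = 0) <->
    f \in coboundaries Y n.
  case: n f => [|n] f; first split=> [f0|/eqP-> //].
    by apply/eqP/hom_ext => x; apply: f0.
  split=> [f0|/coboundariesSP[g <-] x /eqP /= ->]; last exact: linear0.
  have [|g gE] :=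
      @injective_factor _ _ _ _ (chain_diff X n) (f : HomMod _ _) I_inj.
    by move=> x /eqP dx; apply: f0.
  by apply/coboundariesSP; exists g; apply: hom_ext.
pose Z := submodule (cycles X n).
pose inc : {linear Z -> X n} := \val.
pose pr : {linear Z -> homology X n} := mk_linear (@quotmod_pi_linear _ _ _).
have prE z : pr z = 0 <-> \val z \in boundaries X n.
  exact: quotmod_pi_eq0.
have pr_surj q : exists z, pr z = q by elim/quotW: q => z; exists z.
have ind (phi : submodule (cocycles Y n)) :
    exists u : HomMod (homology X n) I, forall z, u (pr z) = \val phi (inc z).
  apply: (@quotmod_lift _ _ _ _ (\val phi \o inc)) => z /boundariesP[x xz].
  have /eqP/(congr1 (fun f : HomMod _ _ => f x)) := valP phi.
  by rewrite /= xz.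
(* The map induced by a cocycle is unique as pr is onto, so a choice of such maps
   is automatically linear. *)
have [k kE] := choice ind.
have kL : linear k.
  move=> a f g; apply: hom_ext => q; have [z <-] := pr_surj q.
  by rewrite /= !kE.
apply: (@subquotient_isomorphic _ _ _ _ _ (mk_linear kL)) => [phi|u] /=.
- have -> : k phi = 0 <-> forall z, \val phi (inc z) = 0.
    split=> [k0 z|phi0]; first by rewrite -kE k0.
    by apply: hom_ext => q; have [z <-] := pr_surj q; rewrite kE phi0.
  split=> [phi0|phiB z]; last by apply: (iffRL (kerE _)) phiB _ (valP z).
  by apply/kerE => x xZ; apply: (phi0 (in_submodule xZ)).
- have [g gE] := I_inj _ _ inc (u \o pr) val_inj.
  have gZ : (g : Y n) \in cocycles Y n.
    rewrite cocyclesE; apply/eqP/hom_ext => x /=.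
    have dxZ : chain_diff X n x \in cycles X n.
      by case: (n) x => [|m] x //; rewrite cyclesSE chain_diff_diff.
    rewrite -[LHS]/(g (inc (in_submodule dxZ))) gE -[RHS](linear0 u).
    by congr (u _); apply/prE/boundariesP; exists x.
  exists (in_submodule gZ).
  by apply: hom_ext => q; have [z <-] := pr_surj q; rewrite kE gE.
Qed.

(** * Comparison of relatively projective resolutions *)

(** The comparison theorem is needed for modules and, with all arrows reversed,
    for coresolutions; an abstract category lets a single proof serve both.
    Additivity of composition is stated for differences, from which its
    compatibility with 0 follows. *)
Record additive_category := AdditiveCategory {
  object :> Type;
  hom : object -> object -> zmodType;
  compose : forall {a b c}, hom b c -> hom a b -> hom a c;
  id1 : forall a, hom a a;
  compA : forall a b c d (f : hom c d) (g : hom b c) (h : hom a b),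
    compose f (compose g h) = compose (compose f g) h;
  comp1f : forall a b (f : hom a b), compose (id1 b) f = f;
  compf1 : forall a b (f : hom a b), compose f (id1 a) = f;
  compBl : forall a b c (f g : hom b c) (h : hom a b),
    compose (f - g) h = compose f h - compose g h;
  compBr : forall a b c (f : hom b c) (g h : hom a b),
    compose f (g - h) = compose f g - compose f h
}.

Definition opposite (A : additive_category) : additive_category :=
  @AdditiveCategory A (fun a b => hom b a) (fun a b c f g => compose g f)
    (@id1 A) (fun a b c d f g h => esym (compA h g f))
    (fun a b => @compf1 A b a) (fun a b => @comp1f A b a)
    (fun a b c f g h => compBr h f g) (fun a b c f g h => compBl g h f).

(** Q is the condition that permits the next recursive choice and that every
    choice must propagate. *)
Lemma dependent_chain (T : nat -> Type) (Q : forall n, T n -> Prop)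
    (P : forall n, T n -> T n.+1 -> Prop) (x0 : T 0) :
    (forall n x, Q n x -> exists2 y, P n x y & Q n.+1 y) -> Q 0 x0 ->
  exists2 f : forall n, T n, f 0 = x0 & forall n, P n (f n) (f n.+1).
Proof.
move=> step Qx0; pose S n := {x : T n | Q n x}.
have next n (s : S n) : {s' : S n.+1 | P n (sval s) (sval s')}.
  apply: cid; case: s => x Qx; have [y Pxy Qy] := step _ _ Qx.
  by exists (exist _ y Qy).
pose f := fix f n : S n :=
  match n with 0 => exist _ x0 Qx0 | m.+1 => sval (next m (f m)) end.
by exists (fun n => sval (f n)) => // n; exact: svalP (next n (f n)).
Qed.

Section Comparison.
Variable A : additive_category.

Lemma comp0f (a b c : A) (h : hom a b) : compose (0 : hom b c) h = 0.
Proof. by rewrite -(subrr (0 : hom b c)) compBl subrr. Qed.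

Lemma compf0 (a b c : A) (f : hom b c) : compose f (0 : hom a b) = 0.
Proof. by rewrite -(subrr (0 : hom a b)) compBr subrr. Qed.

Record cat_complex := CatComplex {
  cat_obj :> nat -> A;
  cat_diff : forall n, hom (cat_obj n.+1) (cat_obj n);
  cat_diff_diff : forall n, compose (cat_diff n) (cat_diff n.+1) = 0
}.

Definition is_cycle (T : A) (X : cat_complex) (n : nat) : hom T (X n) -> Prop :=
  match n return hom T (X n) -> Prop with
  | 0 => fun=> True
  | m.+1 => fun f => compose (cat_diff X m) f = 0
  end.

(** Exactness of Hom(T, X), where X is the complex L^+ with the resolved object
    in degree 0. *)
Definition lifts_cycles (T : A) (X : cat_complex) : Prop :=
  forall n (f : hom T (X n)), is_cycle f -> exists g, compose (cat_diff X n) g = f.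

(** F_{n+1} is a lift of F_n d along d; such a lift exists as soon as F_n d is a
    cycle, and then F_{n+1} d is one as well. *)
Lemma comparison_map (X Y : cat_complex) (u : hom (X 0) (Y 0)) :
    (forall n, lifts_cycles (X n.+1) Y) ->
  exists2 F : forall n, hom (X n) (Y n),
    F 0 = u & forall n, compose (cat_diff Y n) (F n.+1) = compose (F n) (cat_diff X n).
Proof.
move=> XY.
apply: (@dependent_chain (fun n => hom (X n) (Y n))
  (fun n F => is_cycle (compose F (cat_diff X n)))
  (fun n F F' => compose (cat_diff Y n) F' = compose F (cat_diff X n))) => // n F QF.
have [F' F'E] := XY n n _ QF; exists F' => //=.
by rewrite compA F'E -compA cat_diff_diff compf0.
Qed.

(** With D = E - 1, the map h_{n+1} is a lift of D_{n+1} - h_n d along d.  This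
    difference is a cycle when d h_n d = D_n d, a condition that passes to
    n + 1; it holds for h_0 = 0 because D_0 = 0. *)
Lemma comparison_homotopy (X : cat_complex) (E : forall n, hom (X n) (X n)) :
    (forall n, lifts_cycles (X n.+1) X) ->
    E 0 = id1 (X 0) ->
    (forall n, compose (cat_diff X n) (E n.+1) = compose (E n) (cat_diff X n)) ->
  exists2 h : forall n, hom (X n) (X n.+1),
    h 0 = 0 &
    forall n, E n.+1 - id1 (X n.+1)
            = compose (cat_diff X n.+1) (h n.+1) + compose (h n) (cat_diff X n).
Proof.
move=> XX E0 Ed.
pose D n := E n - id1 (X n).
have Dd n : compose (cat_diff X n) (D n.+1) = compose (D n) (cat_diff X n).
  by rewrite compBl compBr Ed comp1f compf1.
have [||h h0 hE] := @dependent_chain (fun n => hom (X n) (X n.+1))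
  (fun n h => compose (compose (cat_diff X n) h) (cat_diff X n)
              = compose (D n) (cat_diff X n))
  (fun n h h' => D n.+1 = compose (cat_diff X n.+1) h' + compose h (cat_diff X n)) 0.
- move=> n h Qh.
  have [|h' h'E] := XX n n.+1 (D n.+1 - compose h (cat_diff X n)).
    by rewrite /= compBr Dd compA Qh subrr.
  exists h'; first by rewrite h'E subrK.
  by rewrite h'E compBl -[in X in _ - X]compA cat_diff_diff compf0 subr0.
- by rewrite compf0 comp0f /D E0 subrr comp0f.
by exists h.
Qed.

Lemma comparison (X Y : cat_complex) (u : hom (X 0) (Y 0)) (v : hom (Y 0) (X 0)) :
    compose u v = id1 _ -> compose v u = id1 _ ->
    (forall n, lifts_cycles (X n.+1) X /\ lifts_cycles (X n.+1) Y) ->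
    (forall n, lifts_cycles (Y n.+1) X /\ lifts_cycles (Y n.+1) Y) ->
  exists (F : forall n, hom (X n) (Y n)) (G : forall n, hom (Y n) (X n)),
    [/\ (forall n, compose (cat_diff Y n) (F n.+1) = compose (F n) (cat_diff X n)),
        (forall n, compose (cat_diff X n) (G n.+1) = compose (G n) (cat_diff Y n)),
        exists2 h : forall n, hom (X n) (X n.+1), h 0 = 0 &
          forall n, compose (G n.+1) (F n.+1) - id1 (X n.+1)
            = compose (cat_diff X n.+1) (h n.+1) + compose (h n) (cat_diff X n)
      & exists2 h : forall n, hom (Y n) (Y n.+1), h 0 = 0 &
          forall n, compose (F n.+1) (G n.+1) - id1 (Y n.+1)
            = compose (cat_diff Y n.+1) (h n.+1) + compose (h n) (cat_diff Y n)].
Proof.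
move=> uv vu Xl Yl.
have [F F0 Fd] := comparison_map u (fun n => (Xl n).2).
have [G G0 Gd] := comparison_map v (fun n => (Yl n).1).
exists F, G; split=> //.
- apply: (comparison_homotopy (E := fun n => compose (G n) (F n))) => [n|//|n].
  + exact: (Xl n).1.
  + by rewrite F0 G0.
  + by rewrite compA Gd -compA Fd compA.
- apply: (comparison_homotopy (E := fun n => compose (F n) (G n))) => [n|//|n].
  + exact: (Yl n).2.
  + by rewrite F0 G0.
  + by rewrite compA Fd -compA Gd compA.
Qed.

End Comparison.

Section Resolutions.
Variable R : comPzRingType.

Lemma hom_app (U V : lmodType R) (f g : HomMod U V) : f = g -> f =1 g.
Proof. by move=> ->. Qed.

Definition module_category : additive_category.
Proof.
apply: (@AdditiveCategory (lmodType R) (fun A B => HomMod A B)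
  (fun A B D f g => hom_post f g) (fun A => idfun)) => //.
- by move=> *; apply: hom_ext.
- by move=> *; apply: hom_ext.
- by move=> *; apply: hom_ext.
- by move=> *; apply: hom_ext.
- by move=> *; rewrite linearB.
Defined.

(** On a cocycle f the summand f d h of f (E - 1) vanishes, which leaves the
    coboundary f h d.  The index shift comes from the augmented complex, where
    K_n sits in degree n + 1; for n = 0 the remaining term is f h_0 aug = 0. *)
Lemma Hom_from_null_homotopic (M Y : lmodType R) (K : augmented M)
    (E : forall n, {linear K n -> K n})
    (h : forall n, HomMod (plus_obj K n) (plus_obj K n.+1)) :
    h 0 = 0 ->
    (forall n x, E n x - x = chain_diff K n (h n.+1 x) + h n (plus_diff K n x)) ->
  forall n f, f \in cocycles (Hom_from_chain Y K) n ->
    hom_pre (E n) f - f \in coboundaries (Hom_from_chain Y K) n.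
Proof.
move=> h0 hE n f /eqP df.
have fE x : f (E n x) - f x = f (h n (plus_diff K n x)).
  have /(congr1 (fun g : HomMod _ _ => g (h n.+1 x))) /= fd := df.
  by rewrite -linearB hE linearD fd add0r.
case: n f {df} fE => [|n] f fE.
  apply/eqP/hom_ext => x; apply: (etrans (fE x)).
  by rewrite h0 -[RHS](linear0 f).
apply/coboundariesSP; exists (hom_pre (h n.+1) f).
by apply: hom_ext => x; rewrite /= -fE.
Qed.

Lemma Hom_to_null_homotopic (M N : lmodType R) (J : coaugmented N)
    (E : forall n, {linear J n -> J n})
    (h : forall n, HomMod (coplus_obj J n.+1) (coplus_obj J n)) :
    h 0 = 0 ->
    (forall n x, E n x - x = h n.+1 (cochain_diff J n x) + coplus_diff J n (h n x)) ->
  forall n f, f \in cocycles (Hom_to_cochain M J) n ->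
    hom_post (E n) f - f \in coboundaries (Hom_to_cochain M J) n.
Proof.
move=> h0 hE n f /eqP df.
have fE x : E n (f x) - f x = coplus_diff J n (h n (f x)).
  have /(congr1 (fun g : HomMod _ _ => g x)) /= fd := df.
  by rewrite hE fd linear0 add0r.
case: n f {df} fE => [|n] f fE.
  apply/eqP/hom_ext => x; apply: (etrans (fE x)).
  by rewrite h0 -[RHS](linear0 (coaug_map J)).
apply/coboundariesSP; exists (hom_post (h n.+1) f).
by apply: hom_ext => x; rewrite /= -fE.
Qed.

(** The comparison maps over the identity of M are inverse to each other up to
    homotopy, and Hom(-, Y) respects homotopies. *)
Lemma relative_Ext_independent (M Y : lmodType R) (L L' : augmented M) (i : nat) :
    (forall n, chain_exact (Hom_to_chain (L n) (chain_plus L)) /\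
               chain_exact (Hom_to_chain (L n) (chain_plus L'))) ->
    (forall n, chain_exact (Hom_to_chain (L' n) (chain_plus L)) /\
               chain_exact (Hom_to_chain (L' n) (chain_plus L'))) ->
  isomorphic (cohomology (Hom_from_chain Y L) i)
             (cohomology (Hom_from_chain Y L') i).
Proof.
move=> Ll L'l.
have cd (K : augmented M) n : compose (a := _ : module_category)
    (plus_diff K n : HomMod _ _) (plus_diff K n.+1 : HomMod _ _) = 0.
  by apply: hom_ext => x; exact: plus_diff_diff.
pose cx (K : augmented M) : cat_complex module_category := CatComplex (cd K).
have liftsE T K : chain_exact (Hom_to_chain T (chain_plus K)) ->
    lifts_cycles (T : module_category) (cx K).
  move=> ex n f fZ; have fc : f \in cycles (Hom_to_chain T (chain_plus K)) n.
    by case: n f fZ => [|n] f fZ //; apply/eqP.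
  by have /boundariesP[g gE] := ex n f fc; exists g.
have [||n|n|F [G [Fd Gd [h h0 hE] [k k0 kE]]]] := @comparison module_category
  (cx L) (cx L') (idfun : HomMod M M) (idfun : HomMod M M).
- by apply: hom_ext.
- by apply: hom_ext.
- by have [] := Ll n; split; apply: liftsE.
- by have [] := L'l n; split; apply: liftsE.
apply: (@cohomology_isomorphic _ (Hom_from_chain Y L) (Hom_from_chain Y L')
  (fun n => hom_pre (G n.+1)) (fun n => hom_pre (F n.+1))) => [n f|n f||].
- by apply: hom_ext => x; apply: (congr1 f (esym (hom_app (Gd n.+1) x))).
- by apply: hom_ext => x; apply: (congr1 f (esym (hom_app (Fd n.+1) x))).
- move=> n f fZ.
  rewrite [X in X - _](_ : _ = hom_pre (hom_post (G n.+1) (F n.+1)) f);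
    last exact: hom_ext.
  apply: (@Hom_from_null_homotopic M Y L
    (fun n => hom_post (G n.+1) (F n.+1)) h h0) fZ => m x.
  exact: (hom_app (hE m)).
- move=> n f fZ.
  rewrite [X in X - _](_ : _ = hom_pre (hom_post (F n.+1) (G n.+1)) f);
    last exact: hom_ext.
  apply: (@Hom_from_null_homotopic M Y L'
    (fun n => hom_post (F n.+1) (G n.+1)) k k0) fZ => m x.
  exact: (hom_app (kE m)).
Qed.

(** The same argument in the opposite category, where a coresolution is a
    resolution. *)
Lemma relative_coExt_independent (M N : lmodType R) (J J' : coaugmented N)
    (i : nat) :
    (forall n, chain_exact (Hom_from_cochain (J n) (cochain_plus J)) /\
               chain_exact (Hom_from_cochain (J n) (cochain_plus J'))) ->
    (forall n, chain_exact (Hom_from_cochain (J' n) (cochain_plus J)) /\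
               chain_exact (Hom_from_cochain (J' n) (cochain_plus J'))) ->
  isomorphic (cohomology (Hom_to_cochain M J) i)
             (cohomology (Hom_to_cochain M J') i).
Proof.
move=> Jl J'l.
have cd (K : coaugmented N) n : compose (a := _ : (opposite module_category))
    (coplus_diff K n : HomMod _ _) (coplus_diff K n.+1 : HomMod _ _) = 0.
  by apply: hom_ext => x; exact: coplus_diff_diff.
pose cx (K : coaugmented N) : cat_complex (opposite module_category) :=
  CatComplex (cd K).
have liftsE T K : chain_exact (Hom_from_cochain T (cochain_plus K)) ->
    lifts_cycles (T : (opposite module_category)) (cx K).
  move=> ex n f fZ.
  have fc : f \in cycles (Hom_from_cochain T (cochain_plus K)) n.
    by case: n f fZ => [|n] f fZ //; apply/eqP.
  by have /boundariesP[g gE] := ex n f fc; exists g.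
have [||n|n|F [G [Fd Gd [h h0 hE] [k k0 kE]]]] := @comparison (opposite module_category)
  (cx J) (cx J') (idfun : HomMod N N) (idfun : HomMod N N).
- by apply: hom_ext.
- by apply: hom_ext.
- by have [] := Jl n; split; apply: liftsE.
- by have [] := J'l n; split; apply: liftsE.
apply: (@cohomology_isomorphic _ (Hom_to_cochain M J) (Hom_to_cochain M J')
  (fun n => hom_post (G n.+1)) (fun n => hom_post (F n.+1))) => [n f|n f||].
- by apply: hom_ext => x; apply: (esym (hom_app (Gd n.+1) (f x))).
- by apply: hom_ext => x; apply: (esym (hom_app (Fd n.+1) (f x))).
- move=> n f fZ.
  rewrite [X in X - _](_ : _ = hom_post (hom_post (F n.+1) (G n.+1)) f);
    last exact: hom_ext.
  apply: (@Hom_to_null_homotopic M N J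
    (fun n => hom_post (F n.+1) (G n.+1)) h h0) fZ => m x.
  exact: (hom_app (hE m)).
- move=> n f fZ.
  rewrite [X in X - _](_ : _ = hom_post (hom_post (G n.+1) (F n.+1)) f);
    last exact: hom_ext.
  apply: (@Hom_to_null_homotopic M N J'
    (fun n => hom_post (G n.+1) (F n.+1)) k k0) fZ => m x.
  exact: (hom_app (kE m)).
Qed.

End Resolutions.

(** * Tensor-Hom adjunction *)

Section Adjunction.
Variable R : comPzRingType.
Implicit Types A B T X I : lmodType R.

Fact mk_bilinear_subproof A B T (b : A -> B -> T) (br : forall x, linear (b x)) :
    (forall y, linear (b^~ y)) ->
  linear (fun x => mk_linear (br x) : HomMod B T).
Proof. by move=> bl a x x'; apply: hom_ext => y; apply: bl. Qed.

Definition mk_bilinear A B T (b : A -> B -> T)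
    (bl : forall y, linear (b^~ y)) (br : forall x, linear (b x)) :
    HomMod A (HomMod B T) :=
  mk_linear (mk_bilinear_subproof br bl).

Lemma tens_linearl A B (y : B) : linear (fun x : A => tens x y).
Proof. by move=> a x x'; rewrite tensDl tensZl. Qed.

Lemma tens_linearr A B (x : A) : linear (tens x : B -> tensor A B).
Proof. by move=> a y y'; rewrite tensDr tensZr. Qed.

Lemma hom_bilinearl A B T (f : HomMod A (HomMod B T)) y :
  linear (fun x => (f x : HomMod B T) y).
Proof. by move=> a x x'; rewrite linearP. Qed.

Lemma hom_bilinearr A B T (f : HomMod A (HomMod B T)) x :
  linear (f x : HomMod B T).
Proof. exact: linearP. Qed.

Definition uncurry A B T (f : HomMod A (HomMod B T)) : HomMod (tensor A B) T :=
  mk_linear (tensor_lift_linear (hom_bilinearl f) (hom_bilinearr f)).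

Lemma uncurryE A B T (f : HomMod A (HomMod B T)) x y :
  uncurry f (tens x y) = (f x : HomMod B T) y.
Proof. exact: (tensor_lift_tens (hom_bilinearl f) (hom_bilinearr f)). Qed.

Fact curry_subproofl A B T (f : HomMod (tensor A B) T) y :
  linear (fun x => f (tens x y)).
Proof. by move=> a x x'; rewrite tens_linearl linearP. Qed.

Fact curry_subproofr A B T (f : HomMod (tensor A B) T) x :
  linear (fun y => f (tens x y)).
Proof. by move=> a y y'; rewrite tens_linearr linearP. Qed.

Definition curry A B T (f : HomMod (tensor A B) T) : HomMod A (HomMod B T) :=
  mk_bilinear (curry_subproofl f) (curry_subproofr f).

Lemma uncurry_linear A B T : linear (@uncurry A B T).
Proof.
move=> a f g; apply: hom_ext; apply: tensor_ext => x y.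
by rewrite uncurryE -[RHS]/(a *: uncurry f (tens x y) + uncurry g (tens x y))
  !uncurryE.
Qed.

Lemma uncurryK A B T : cancel (@uncurry A B T) (@curry A B T).
Proof.
by move=> f; apply: hom_ext => x; apply: hom_ext => y; apply: uncurryE.
Qed.

Lemma curryK A B T : cancel (@curry A B T) (@uncurry A B T).
Proof.
move=> f; apply: hom_ext.
by apply: (@tensor_ext _ _ _ _ (uncurry (curry f)) f) => x y; rewrite uncurryE.
Qed.

Definition hom_swap A B T (f : HomMod A (HomMod B T)) : HomMod B (HomMod A T) :=
  mk_bilinear (fun x => hom_bilinearr f x) (hom_bilinearl f).

Lemma hom_swap_isomorphic A B T :
  isomorphic (HomMod A (HomMod B T)) (HomMod B (HomMod A T)).
Proof.
have sL : linear (@hom_swap A B T).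
  by move=> a f g; apply: hom_ext => y; apply: hom_ext.
exists (mk_linear sL); exists (@hom_swap B A T) => f;
  by apply: hom_ext => x; apply: hom_ext.
Qed.

Lemma Hom_tensor_isomorphic A B T :
  isomorphic (HomMod (tensor A B) T) (HomMod A (HomMod B T)).
Proof.
exists (mk_linear (can_linear (f := mk_linear (@uncurry_linear A B T))
  (@uncurryK A B T) (@curryK A B T))).
by exists (@uncurry A B T); [exact: curryK|exact: uncurryK].
Qed.

Lemma HomMod_isomorphic A B T : isomorphic A B ->
  isomorphic (HomMod A T) (HomMod B T).
Proof.
case/isomorphic_inverse => f [g [fK gK]].
exists (hom_pre g); exists (hom_pre f) => u; apply: hom_ext => x /=.
  by rewrite fK.
by rewrite gK.
Qed.

(** Taken with A = C, this puts C itself in the class P_C. *)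
Lemma isomorphic_unit_tensor A : isomorphic A (tensor R^o A).
Proof.
pose f : {linear A -> tensor R^o A} := mk_linear (@tens_linearr R^o A 1).
have gl (x : A) : linear (fun a : R^o => a *: x).
  by move=> a b c; rewrite scalerDl scalerA.
have gr (a : R^o) : linear (fun x : A => a *: x).
  by move=> b x y; rewrite scalerDr !scalerA mulrC.
pose g := uncurry (mk_bilinear gl gr).
have gE a x : g (tens a x) = a *: x by exact: uncurryE.
exists f; exists g => [x|t].
  by rewrite -[LHS]/(g (tens (1 : R^o) x)) gE scale1r.
apply: (@tensor_ext _ _ _ _ (f \o g) idfun) => a x.
by rewrite -[LHS]/(tens (1 : R^o) (g (tens a x))) gE tensZr -tensZl
  -[_ *: _]/(a * 1) mulr1.
Qed.

End Adjunction.

(** * Modules over a noetherian ring *)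

Section Noetherian.
Variable R : comPzRingType.

Definition fg_submod (U : lmodType R) (S : submodClosed U) : Prop :=
  exists (K : finType) (r : K -> U), (forall k, r k \in S) /\
    forall x, x \in S -> exists a : K -> R, x = \sum_k a k *: r k.

Fact extend0_subproof n :
  linear (fun (x : 'I_n -> R^o) (i : 'I_n.+1) =>
            (if unlift ord0 i is Some j then x j else 0) : R^o).
Proof.
move=> a x y; apply/funext => i.
rewrite -[RHS]/(a * _ + _) /=.
by case: unliftP => [j _|_]; rewrite ?mulr0 ?addr0.
Qed.

Definition extend0 n : {linear ('I_n -> R^o) -> ('I_n.+1 -> R^o)} :=
  mk_linear (@extend0_subproof n).

(** For S in R^(n+1), the first coordinates of elements of S form an ideal, which
    has finitely many generators y_i; they lift to elements p_i of S.  An element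
    of S minus a suitable combination of the p_i has first coordinate 0, so it
    comes from a submodule of R^n, and induction applies. *)
Lemma noetherian_fg_submod n (S : submodClosed ('I_n -> R^o)) :
  noetherian R -> fg_submod S.
Proof.
move=> noeR; elim: n S => [|n IHn] S.
  exists void, (fun k : void => match k with end); split=> [[]|x _].
  by exists (fun k : void => match k with end); apply/funext => -[].
have evL : linear (fun x : submodule S => \val x ord0 : R^o) by [].
have [m [y yE]] := noeR (im_pred (mk_linear evL)).
have /choice[p pE] k : exists x : submodule S, \val x ord0 = \val (y k).
  exact: asboolW (valP (y k)).
have [K [r [rS rE]]] := IHn (preimage_pred (extend0 n) S).
exists ('I_m + K)%type, (fun k => match k with
  | inl i => \val (p i) | inr j => extend0 n (r j) end).
split=> [[i|j]|x xS]; [exact: valP|exact: rS|].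
have xI : x ord0 \in im_pred (mk_linear evL).
  by apply/asboolP; exists (in_submodule xS).
have [a aE] := yE (in_submodule xI).
pose z := x - \sum_i a i *: \val (p i).
have z0 : z ord0 = 0.
  have xE : x ord0 = \sum_i a i *: (\val (y i) : R^o).
    by rewrite -[LHS]/(\val (in_submodule xI)) aE linear_sum.
  rewrite -[LHS]/(x ord0 - (\sum_i a i *: \val (p i)) ord0) xE fct_sumE.
  apply/eqP; rewrite subr_eq0; apply/eqP/eq_bigr => i _.
  by rewrite -pE.
pose w : 'I_n -> R^o := fun j => z (lift ord0 j).
have zE : z = extend0 n w.
  by apply/funext => i /=; case: unliftP => [j ->|->].
have [|b bE] := rE w.
  rewrite -[_ \in _]/(extend0 n w \in S) -zE.
  have [_ SB] := GRing.submod_closedB (GRing.submodClosedP S); apply: SB => //.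
  by apply: rpred_sum => i _; apply: rpredZ; apply: valP.
exists (fun k => match k with inl i => a i | inr j => b j end).
rewrite big_sumType /= -[LHS](subrK (\sum_i a i *: \val (p i))) -/z addrC.
congr (_ + _); rewrite zE bE linear_sum; apply: eq_bigr => j _.
by rewrite linearZ.
Qed.

Definition finitely_presented (C : lmodType R) : Prop :=
  exists (n : nat) (g : 'I_n -> C) (K : finType) (r : K -> 'I_n -> R),
    [/\ forall x, exists a : 'I_n -> R, x = \sum_i a i *: g i,
        forall k, \sum_i r k i *: g i = 0
      & forall x : 'I_n -> R, \sum_i x i *: g i = 0 ->
          exists a : K -> R, forall i, x i = \sum_k a k * r k i].

Lemma noetherian_finitely_presented (C : lmodType R) :
  noetherian R -> finitely_generated C -> finitely_presented C.
Proof.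
move=> noeR [n [g gE]].
have eL : linear (fun x : 'I_n -> R^o => \sum_i x i *: g i).
  move=> a x y; rewrite scaler_sumr -big_split /=; apply: eq_bigr => i _.
  by rewrite scalerA -scalerDl.
have [K [r [rS rE]]] := noetherian_fg_submod (ker_pred (mk_linear eL)) noeR.
exists n, g, K, r; split=> // [k|x x0]; first exact/eqP/rS.
have [|a aE] := rE x; first exact/eqP.
by exists a => i; rewrite aE fct_sumE.
Qed.

End Noetherian.

(** * Tensor evaluation and the dual of a proper resolution *)

Section FunctionModule.
Variables (R : pzRingType) (K : finType) (X : lmodType R).

Fact single_subproof k :
  linear (fun (x : X) (j : K) => if j == k then x else 0).
Proof.
move=> a x y; apply/funext => j; rewrite -[RHS]/(a *: _ + _) /=.
by case: eqP => // _; rewrite scaler0 addr0.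
Qed.

Definition single k : {linear X -> (K -> X)} := mk_linear (@single_subproof k).

Lemma sum_single (x : K -> X) : x = \sum_k single k (x k).
Proof.
apply/funext => j; rewrite fct_sumE (bigD1 j) //= eqxx big1 ?addr0 //.
by move=> k /negPf; rewrite eq_sym => ->.
Qed.

End FunctionModule.

(** P is a direct summand of the free module on its own elements, through p and
    its section s.  A map A -> Hom(P, I) is a family of maps A -> I indexed by
    the elements of P; extending each of them to B gives a map
    B -> Hom(freemod R P, I), which s restricts to Hom(P, I). *)
Lemma injective_Hom_projective (R : comPzRingType) (P I : lmodType R) :
  projective_module P -> injective_module I -> injective_module (HomMod P I).
Proof.
move=> P_proj I_inj A B j f j_inj.
pose p : {linear freemod R P -> P} := @freemod_ext R P P id.
have [|s sE] := P_proj _ _ p idfun.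
  by move=> x; exists (fbasis R x); exact: freemod_ext_basis.
have /choice[g gE] x : exists g : {linear B -> I}, forall a,
    g (j a) = (f a : HomMod P I) x.
  exact: (I_inj _ _ j (hom_swap f x) j_inj).
pose h b : {linear freemod R P -> I} := @freemod_ext R P I (fun x => g x b).
have hL b : linear (h b \o s) by exact: linearP.
have hR x : linear (fun b => h b (s x)).
  move=> a b c.
  rewrite -[RHS]/((a *: (h b : HomMod _ _) + h c : HomMod _ _) (s x)).
  rewrite [RHS]freemod_extE; congr (freemod_ext _ _); apply/funext => y.
  by rewrite -[RHS]/(a *: h b (fbasis R y) + h c (fbasis R y))
    /h /= !freemod_ext_basis linearP.
exists (mk_bilinear hR hL) => a; apply: hom_ext => x /=.
have -> : h (j a) =1 f a \o p.
  move=> u; rewrite [RHS]freemod_extE; congr (freemod_ext _ u); apply/funext => y.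
  by rewrite gE /= freemod_ext_basis.
by rewrite /= sE.
Qed.

Section TensorEvaluation.
Variables (R : comPzRingType) (C I : lmodType R).

(** The evaluation C (x) Hom(X, I) -> Hom(Hom(C, X), I), c (x) u |-> u (f c), taken
    with f first, which makes it linear in the tensor by construction. *)
Definition tensor_eval (X : lmodType R) (f : HomMod C X) :
    HomMod (tensor C (HomMod X I)) I :=
  uncurry (hom_swap (mk_linear (hom_pre_linear f) :
    HomMod (HomMod X I) (HomMod C I))).

Lemma tensor_evalE (X : lmodType R) (f : HomMod C X) c (u : HomMod X I) :
  tensor_eval f (tens c u) = u (f c).
Proof. exact: uncurryE. Qed.

Lemma tensor_eval_linear (X : lmodType R) (t : tensor C (HomMod X I)) :
  linear (fun f => tensor_eval f t).
Proof.
move=> a f g.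
apply: (@tensor_ext _ _ _ _ (tensor_eval (a *: f + g))
  (a *: (tensor_eval f : HomMod _ _) + tensor_eval g : HomMod _ _)) => c u.
rewrite -[RHS]/(a *: tensor_eval f (tens c u) + tensor_eval g (tens c u)).
by rewrite !tensor_evalE -linearP.
Qed.

Lemma tensor_eval_natural (X Y : lmodType R) (a : {linear X -> Y})
    (f : HomMod C X) (t : tensor C (HomMod Y I)) :
  tensor_eval f (tensor_map idfun (hom_pre a) t) = tensor_eval (hom_post a f) t.
Proof.
apply: (@tensor_ext _ _ _ _
  (tensor_eval f \o tensor_map idfun (@hom_pre R _ _ I a))
  (tensor_eval (hom_post a f))) => c u.
rewrite -[LHS]/(tensor_eval f (tensor_map _ _ (tens c u))) tensor_map_tens.
by rewrite !tensor_evalE.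
Qed.

Lemma tens_suml (A B : lmodType R) (J : finType) (x : J -> A) (y : B) :
  tens (\sum_j x j) y = \sum_j tens (x j) y.
Proof. exact: (linear_sum (mk_linear (@tens_linearl _ _ _ y))). Qed.

Lemma tens_sumr (A B : lmodType R) (J : finType) (x : A) (y : J -> B) :
  tens x (\sum_j y j) = \sum_j tens x (y j).
Proof. exact: (linear_sum (mk_linear (@tens_linearr _ _ _ x))). Qed.

(** The sums of the g_i (x) w_i form a submodule, and the projection onto the
    quotient by it vanishes on pure tensors. *)
Lemma tensor_generators (V : lmodType R) n (g : 'I_n -> C) :
    (forall x, exists a : 'I_n -> R, x = \sum_i a i *: g i) ->
  forall t : tensor C V, exists w : 'I_n -> V, t = \sum_i tens (g i) (w i).
Proof.
move=> gE t.
have sL : linear (fun w : 'I_n -> V => \sum_i tens (g i) (w i)).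
  move=> a v w; rewrite scaler_sumr -big_split /=; apply: eq_bigr => i _.
  by rewrite -tens_linearr.
pose s := mk_linear sL; pose Q := quotmod (im_pred s).
pose q : {linear tensor C V -> Q} := mk_linear (@quotmod_pi_linear _ _ _).
have q0 : q t = 0.
  apply: (@tensor_ext _ _ _ _ q \0) => x v; apply/quotmod_pi_eq0.
  have [a ->] := gE x; apply/asboolP; exists (fun i => a i *: v).
  rewrite tens_suml; apply: eq_bigr => i _.
  by rewrite tensZl tensZr.
by have /quotmod_pi_eq0/asboolP[w <-] := q0; exists w.
Qed.

Hypothesis C_fp : finitely_presented C.
Hypothesis I_inj : injective_module I.

(** Evaluation at generators g_i embeds Hom(C, X) into X^n.  Extending w to X^n
    and taking components w_i gives w f = sum_i w_i (f g_i). *)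
Lemma tensor_eval_surjective (X : lmodType R) (w : {linear HomMod C X -> I}) :
  exists t, forall f, tensor_eval f t = w f.
Proof.
have [n [g [K [r [gE rg rE]]]]] := C_fp.
have qL : linear (fun (f : HomMod C X) (i : 'I_n) => f (g i)) by [].
have [|W WE] := @injective_factor _ _ _ _ (mk_linear qL) w I_inj.
  move=> f f0; rewrite (_ : f = 0) ?linear0 //; apply: hom_ext => x.
  have [a ->] := gE x; rewrite linear_sum; apply: big1 => i _.
  by rewrite linearZ /= (congr1 (fun v => v i) f0 : f (g i) = 0) scaler0.
exists (\sum_i tens (g i) (W \o single X i : HomMod X I)) => f.
rewrite linear_sum -WE (sum_single (mk_linear qL f)) linear_sum.
by apply: eq_bigr => i _; rewrite tensor_evalE.
Qed.

(** Write t as the sum of the g_i (x) w_i.  If it evaluates to 0, then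
    x |-> sum_i w_i x_i vanishes on those x in X^n that satisfy the relations of
    C, since they are the families (f g_i) for f : C -> X.  Hence it factors
    through the relation map X^n -> X^K, by a map with components v_k, that is,
    w_i = sum_k r_ki v_k.  Moving r_ki across the tensor sign yields
    sum_k (sum_i r_ki g_i) (x) v_k = 0. *)
Lemma tensor_eval_injective (X : lmodType R) (t : tensor C (HomMod X I)) :
  (forall f, tensor_eval f t = 0) -> t = 0.
Proof.
have [n [g [K [r [gE rg rE]]]]] := C_fp => t0.
have [w tE] := tensor_generators gE t.
have rL : linear (fun (x : 'I_n -> X) (k : K) => \sum_i r k i *: x i).
  move=> a x y; apply/funext => k; rewrite -[RHS]/(a *: (_ : X) + _).
  rewrite scaler_sumr -big_split /=; apply: eq_bigr => i _.
  by rewrite -[(_ + _) i]/(a *: x i + y i) scalerDr !scalerA mulrC.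
have PL : linear (fun x : 'I_n -> X => \sum_i w i (x i)).
  move=> a x y; rewrite scaler_sumr -big_split /=; apply: eq_bigr => i _.
  by rewrite -linearP.
have [|v vE] := @injective_factor _ _ _ _ (mk_linear rL) (mk_linear PL) I_inj.
  move=> x /= rx0.
  have x0 b : \sum_i b i *: g i = 0 -> \sum_i b i *: x i = 0.
    move=> /rE[a bE].
    transitivity (\sum_k a k *: \sum_i r k i *: x i); last first.
      apply: big1 => k _.
      by rewrite (congr1 (fun v => v k) rx0 : \sum_i _ = 0) scaler0.
    under [RHS]eq_bigr do rewrite scaler_sumr.
    rewrite exchange_big; apply: eq_bigr => i _.
    by rewrite bE scaler_suml; apply: eq_bigr => k _; rewrite scalerA.
  (* x satisfies the relations, so g_i |-> x_i extends to a map on C: express c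
     in the generators by any coefficients a c. *)
  have [a aE] := choice gE.
  have wd b c : \sum_i b i *: g i = c -> \sum_i a c i *: x i = \sum_i b i *: x i.
    move=> bc; apply/eqP; rewrite -subr_eq0 -sumrB; apply/eqP.
    under eq_bigr do rewrite -scalerBl; apply: x0.
    under eq_bigr do rewrite scalerBl.
    by rewrite sumrB -aE bc subrr.
  have fL : linear (fun c => \sum_i a c i *: x i).
    move=> b c d; rewrite scaler_sumr -big_split /=.
    under [RHS]eq_bigr do rewrite scalerA -scalerDl.
    apply: wd; under eq_bigr do rewrite scalerDl -scalerA.
    by rewrite big_split -scaler_sumr -!aE.
  rewrite -[RHS](t0 (mk_linear fL)) tE linear_sum; apply: eq_bigr => i _.
  rewrite tensor_evalE /=; congr (w i _).
  rewrite (wd (fun j => (j == i)%:R)).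
    rewrite (bigD1 i) //= eqxx scale1r big1 ?addr0 // => j /negPf->.
    by rewrite scale0r.
  rewrite (bigD1 i) //= eqxx scale1r big1 ?addr0 // => j /negPf->.
  by rewrite scale0r.
have wE i : w i = \sum_k r k i *: (v \o single X k : HomMod X I).
  apply: hom_ext => x.
  have eL : linear (fun f : HomMod X I => f x) by [].
  rewrite -[RHS]/(mk_linear eL _) linear_sum.
  transitivity (mk_linear PL (single X i x)).
    rewrite /= (bigD1 i) //= eqxx big1 ?addr0 // => j /negPf->.
    exact: linear0.
  rewrite -vE (sum_single (mk_linear rL _)) linear_sum; apply: eq_bigr => k _.
  rewrite -[RHS]/(r k i *: v (single X k x)) -!linearZ; congr (v (single _ _ _)).
  rewrite /= (bigD1 i) //= eqxx big1 ?addr0 // => j /negPf->.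
  exact: scaler0.
rewrite tE; under eq_bigr do rewrite wE tens_sumr.
rewrite exchange_big; apply: big1 => k _.
under eq_bigr do rewrite tensZr -tensZl.
by rewrite -tens_suml rg tens0l.
Qed.

End TensorEvaluation.

(** By adjunction phi is a map Phi from C (x) Hom(B, I) to the injective module E,
    so it extends along C (x) Hom(B, I) -> C (x) Hom(A, I) if it vanishes on the
    kernel.  An element t of this kernel evaluates to a functional on Hom(C, B)
    that vanishes on the image of Hom(C, A), hence factors through Hom(C, D);
    bijectivity of the evaluation shows that t comes from C (x) Hom(D, I), where
    Phi is 0 by the assumption on phi. *)
Lemma dual_exact (R : comPzRingType) (C I E A B D : lmodType R)
    (a : {linear A -> B}) (b : {linear B -> D})
    (phi : {linear HomMod B I -> HomMod C E}) :
    finitely_presented C -> injective_module I -> injective_module E ->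
    (forall f : HomMod C B, hom_post b f = 0 -> exists g, hom_post a g = f) ->
    (forall u, phi (hom_pre b u) = 0) ->
  exists psi : {linear HomMod A I -> HomMod C E},
    forall u, psi (hom_pre a u) = phi u.
Proof.
move=> C_fp I_inj E_inj ab phib.
pose Phi := uncurry (hom_swap (phi : HomMod _ _)).
have PhiE c u : Phi (tens c u) = (phi u : HomMod C E) c by exact: uncurryE.
pose q := tensor_map (idfun : {linear C -> C}) (@hom_pre R _ _ I a).
have [t qt0|Psi PsiE] := @injective_factor _ _ _ _ q Phi E_inj; last first.
  exists (hom_swap (curry Psi)) => u; apply: hom_ext => c.
  rewrite -PhiE -PsiE; apply: (congr1 Psi).
  exact/esym/tensor_map_tens.
have [f bf0|w wE] := @injective_factor _ _ _ _ (@hom_post R C _ _ b)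
  (mk_linear (tensor_eval_linear t)) I_inj.
  have [g <-] := ab f bf0.
  rewrite -[LHS]/(tensor_eval I (hom_post a g) t) -tensor_eval_natural.
  by rewrite (qt0 : tensor_map idfun (hom_pre a) t = 0) linear0.
have [s sE] := tensor_eval_surjective C_fp I_inj w.
have -> : t = tensor_map idfun (hom_pre b) s.
  apply/eqP; rewrite -subr_eq0; apply/eqP/(tensor_eval_injective C_fp I_inj) => f.
  by rewrite linearB tensor_eval_natural sE wE subrr.
apply: (@tensor_ext _ _ _ _ (Phi \o tensor_map idfun (@hom_pre R _ _ I b)) \0).
move=> c u; rewrite -[LHS]/(Phi (tensor_map _ _ (tens c u))).
by rewrite tensor_map_tens PhiE phib.
Qed.

Section DualResolution.
Variables (R : comPzRingType) (C N I : lmodType R).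
Hypotheses (R_noetherian : noetherian R) (C_fg : finitely_generated C)
  (I_injective : injective_module I).

Lemma IC_HomMod (X : lmodType R) : PC C X -> IC C (HomMod X I).
Proof.
move=> [P [P_proj /isomorphic_inverse[e [e' [eK e'K]]]]].
exists (HomMod P I); split; first exact: injective_Hom_projective.
apply: (@isomorphic_trans _ (HomMod (tensor P C) I)).
  by apply: HomMod_isomorphic; exists e; exists e'.
apply: isomorphic_trans (hom_swap_isomorphic P C I).
exact: Hom_tensor_isomorphic.
Qed.

Lemma PC_self : PC C C.
Proof.
exists R^o; split; last exact: isomorphic_unit_tensor.
move=> A B p f p_surj; have [a pa] := p_surj (f 1).
have gL : linear (fun r : R^o => r *: a).
  by move=> b r s; rewrite scalerDl scalerA.
exists (mk_linear gL) => r.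
by rewrite /= linearZ pa -linearZ; congr (f _); exact: mulr1.
Qed.

Variable L : augmented N.

Fact dual_subproof (u : HomMod N I) :
  cochain_diff (Hom_from_chain I L) 0 (hom_pre (aug_map L) u) = 0.
Proof. by apply: hom_ext => x /=; rewrite aug_map_diff linear0. Qed.

Definition dual_coaugmented : coaugmented (HomMod N I) :=
  @Coaugmented R (HomMod N I) (Hom_from_chain I L) (hom_pre (aug_map L))
    dual_subproof.

Lemma dual_exact_IC (A B D Y : lmodType R)
    (a : {linear A -> B}) (b : {linear B -> D})
    (phi : {linear HomMod B I -> Y}) : IC C Y ->
    (forall f : HomMod C B, hom_post b f = 0 -> exists g, hom_post a g = f) ->
    (forall u, phi (hom_pre b u) = 0) ->
  exists psi : HomMod (HomMod A I) Y, hom_pre (@hom_pre R _ _ I a) psi = phi.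
Proof.
move=> [E [E_inj YE]] ab phib.
have C_fp := noetherian_finitely_presented R_noetherian C_fg.
have [e [e' [eK _]]] := isomorphic_inverse YE.
have [u|psi psiE] := @dual_exact R C I E A B D a b (e \o phi) C_fp I_injective
    E_inj ab.
  by rewrite /= phib linear0.
exists (e' \o psi); apply: hom_ext => u.
by rewrite /= psiE /= eK.
Qed.

(** In each degree [dual_exact] reduces exactness of Hom(Hom(L^+, I), Y) to that of
    Hom(C, L^+), which holds because C is in P_C. *)
Lemma proper_dual_coaugmented : proper_PC_resolution C L ->
  proper_IC_coresolution C dual_coaugmented.
Proof.
move=> [L_PC L_proper]; split=> [n|Y YIC]; first exact: IC_HomMod.
have ex := L_proper C PC_self.
have lift n (f : HomMod C (plus_obj L n)) :
    f \in cycles (Hom_to_chain C (chain_plus L)) n ->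
    exists g, hom_post (plus_diff L n) g = f.
  by move=> fZ; have /boundariesP := ex n f fZ.
move=> n phi phiZ; apply/boundariesP.
case: n phi phiZ => [|n] phi phiZ.
  (* L^+ ends in N, where every map is a cycle; the zero map N -> N stands for
     the map N -> 0. *)
  apply: (@dual_exact_IC (L 0) N N Y (aug_map L) \0 phi) => // [f _|u].
    exact: (lift 0 f).
  by rewrite (_ : hom_pre _ u = 0) ?linear0 //; apply: hom_ext => x;
    exact: linear0.
have phi0 u : phi (coplus_diff dual_coaugmented n u) = 0.
  exact: (hom_app (eqP phiZ) u).
have liftS (f : HomMod C (L n)) : hom_post (plus_diff L n) f = 0 ->
    exists g, hom_post (chain_diff L n) g = f.
  by move=> f0; apply: (lift n.+1 f); apply/eqP.
by case: n phi phiZ phi0 liftS => [|n] phi _ phi0 liftS;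
  apply: (dual_exact_IC YIC liftS phi0).
Qed.

End DualResolution.

(** * Hom-tensor duality for the relative functors *)

Theorem proposition3p14 (R : comPzRingType) (C M N I : lmodType R)
    (R_noetherian : noetherian R) (C_semidualizing : semidualizing C)
    (I_injective : injective_module I) (i : nat) :
  (forall L L' : augmented M,
      proper_PC_resolution C L -> proper_PC_resolution C L' ->
      isomorphic (Ext_PCM L (HomMod N I) i) (HomMod (Tor_PCM L' N i) I)) /\
  (forall (J : coaugmented (HomMod N I)) (L : augmented N),
      proper_IC_coresolution C J -> proper_PC_resolution C L ->
      isomorphic (Ext_MIC M J i) (HomMod (Tor_MPC M L i) I)).
Proof.
have [C_fg _ _] := C_semidualizing.
split=> [L L' [L_PC L_ex] [L'_PC L'_ex]|J L J_proper L_proper].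
- apply: isomorphic_trans (@relative_Ext_independent R M _ L L' i _ _) _.
  + by move=> n; split; [exact: L_ex|exact: L'_ex].
  + by move=> n; split; [exact: L_ex|exact: L'_ex].
  apply: isomorphic_trans
    (cohomology_Hom_injective (tensor_chain_module N L') i I_injective).
  apply: (@cohomology_isomorphic_levelwise _ (Hom_from_chain (HomMod N I) L')
    (Hom_from_chain I (tensor_chain_module N L'))
    (fun n => mk_linear (@uncurry_linear R (L' n) N I))
    (fun n => @curry R (L' n) N I)) => [n f|n|n].
  + apply: hom_ext.
    apply: (@tensor_ext _ _ _ _ (uncurry f \o tensor_map (chain_diff L' n) idfun)
      (uncurry (hom_pre (chain_diff L' n) f))) => x y.
    rewrite -[LHS]/(uncurry f (tensor_map _ _ (tens x y))) tensor_map_tens.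
    by rewrite !uncurryE.
  + exact: uncurryK.
  + exact: curryK.
- have [J'_IC J'_ex] := proper_dual_coaugmented R_noetherian C_fg I_injective
    L_proper.
  have [J_IC J_ex] := J_proper.
  apply: isomorphic_trans (@relative_coExt_independent R M _ J
    (dual_coaugmented I L) i _ _) _.
  + by move=> n; split; [exact: J_ex|exact: J'_ex].
  + by move=> n; split; [exact: J_ex|exact: J'_ex].
  apply: isomorphic_trans
    (cohomology_Hom_injective (tensor_module_chain M L) i I_injective).
  apply: (@cohomology_isomorphic_levelwise _
    (Hom_to_cochain M (dual_coaugmented I L))
    (Hom_from_chain I (tensor_module_chain M L))
    (fun n => mk_linear (@uncurry_linear R M (L n) I))
    (fun n => @curry R M (L n) I)) => [n f|n|n].
  + apply: hom_ext.
    apply: (@tensor_ext _ _ _ _ (uncurry f \o tensor_map idfun (chain_diff L n))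
      (uncurry (hom_post (hom_pre (chain_diff L n)) f))) => x y.
    rewrite -[LHS]/(uncurry f (tensor_map _ _ (tens x y))) tensor_map_tens.
    by rewrite !uncurryE.
  + exact: uncurryK.
  + exact: curryK.
Qed.
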